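(* Let $L$ and $F$ be finite-dimensional coalgebras over $\mathbb{C}$, let $x: L\to \mathrm{Invd}(F)$ be a linear map, with associated algebra morphism $\pi_x:T(L)\to \mathrm{Invd}(T(F))$, whose image is $U_x$. Let $C$ be a finite-dimensional subcoalgebra of $T(L)$. Then the space $R_C(U_x)=C\cap\ker\pi_x$ of relations of $U_x$ contained in $C$ coincides with the maximal coideal of $C$ contained in the set of relations defined by the minimal representation, on $\mathbb{C}\oplus F$, i.e. contained in $\{w\in C:\ \pi_x(w)|_{\mathbb{C}\oplus F}=0\}$.
   Context: All coalgebras are coassociative with counit, over $\mathbb{C}$. A coideal of a coalgebra $C$ is a linear subspace $I\subset C$ with $\Delta_C(I)\subset I\otimes C+C\otimes I$ and $\epsilon_C(I)=0$. $\mathrm{Invd}(C)$ denotes the algebra of right-invariant operators on a coalgebra $C$, i.e. the $A\in \mathrm{End}(C)$ with $\Delta_C\circ A=(A\otimes \mathrm{id})\circ\Delta_C$. The tensor algebra $T(L)=\mathbb{C}\oplus L\oplus (L\otimes L)\oplus\cdots$ is a bialgebra whose coproduct $\Delta_L$ and counit $\epsilon_L$ are the unique unital algebra morphisms extending those of $L$; similarly $T(F)$ with $\Delta_F,\epsilon_F$. For $l\in L$, the operator $X(l)$ on $T(F)$ is determined by: $X(l)(1)=\epsilon_L(l)1$; $X(l)(f)=x(l)(f)$ for $f\in F$; and $X(l)(w_1w_2)=\sum_k X(l_k')(w_1)\,X(l_k'')(w_2)$ for $w_1,w_2\in T(F)$, where $\Delta_L(l)=\sum_k l_k'\otimes l_k''$.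 It is known that $X(l)\in \mathrm{Invd}(T(F))$ and that $X(l)(\otimes^nF)\subset\otimes^nF$ for all $n\ge0$. The map $\pi_x:T(L)\to \mathrm{Invd}(T(F))\subset \mathrm{End}(T(F))$ is the unital algebra morphism (product in the target is composition) with $\pi_x(l)=X(l)$ for $l\in L$. The minimal representation is the restriction of the action $\pi_x$ to the invariant subspace $\mathbb{C}\oplus F\subset T(F)$. *)

(* Defs.v *)
From HB Require Import structures.
From mathcomp Require Import all_boot all_algebra.
From mathcomp Require Import boolp classical_sets reals complex.

Set Implicit Arguments.
Unset Strict Implicit.
Unset Printing Implicit Defensive.

Import GRing.Theory.
Local Open Scope ring_scope.
Local Open Scope quotient_scope.
Local Open Scope classical_set_scope.

Declare Scope tensor_scope.
Delimit Scope tensor_scope with tens.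

Section Hom.
Context {K : fieldType}.

Definition linmap (U V : lmodType K) := {linear U -> V}.
#[global] Arguments linmap (U V)%_type_scope.

Section HomLmodule.
Context {U V : lmodType K}.
Implicit Types f g h : linmap U V.

Lemma hom_ext f g : (forall u, f u = g u) -> f = g.
Proof.
move=> fE; have fg : GRing.Linear.sort f = GRing.Linear.sort g by exact: funext.
case: f g fg {fE} => [f [[c1] [c2]]] [g [[d1] [d2]]] /= fg; subst g.
by rewrite (Prop_irrelevance c1 d1) (Prop_irrelevance c2 d2).
Qed.

Definition mkhom (f : U -> V) (lf : linear f) : linmap U V :=
  HB.pack f (GRing.isLinear.Build K U V *:%R f lf).

HB.instance Definition _ := gen_eqMixin (linmap U V).
HB.instance Definition _ := gen_choiceMixin (linmap U V).

Fact hom_zero_linear : linear (fun _ : U => 0 : V).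
Proof. by move=> a u v; rewrite scaler0 addr0. Qed.
Fact hom_opp_linear f : linear (fun u => - f u).
Proof. by move=> a u v; rewrite linearP opprD scalerN. Qed.
Fact hom_add_linear f g : linear (fun u => f u + g u).
Proof. by move=> a u v; rewrite !linearP scalerDr addrACA. Qed.
Fact hom_scale_linear a f : linear (fun u => a *: f u).
Proof.
by move=> b u v; rewrite linearP scalerDr !scalerA mulrC.
Qed.

Definition hom_zero : linmap U V := mkhom hom_zero_linear.
Definition hom_opp f : linmap U V := mkhom (hom_opp_linear f).
Definition hom_add f g : linmap U V := mkhom (hom_add_linear f g).
Definition hom_scale a f : linmap U V := mkhom (hom_scale_linear a f).

Fact hom_addA : associative hom_add.
Proof. by move=> f g h; apply: hom_ext => u /=; rewrite addrA. Qed.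
Fact hom_addC : commutative hom_add.
Proof. by move=> f g; apply: hom_ext => u /=; rewrite addrC. Qed.
Fact hom_add0 : left_id hom_zero hom_add.
Proof. by move=> f; apply: hom_ext => u /=; rewrite add0r. Qed.
Fact hom_addN : left_inverse hom_zero hom_opp hom_add.
Proof. by move=> f; apply: hom_ext => u /=; rewrite addNr. Qed.

HB.instance Definition _ :=
  GRing.isZmodule.Build (linmap U V) hom_addA hom_addC hom_add0 hom_addN.

Fact hom_scaleA a b f : hom_scale a (hom_scale b f) = hom_scale (a * b) f.
Proof. by apply: hom_ext => u /=; rewrite scalerA. Qed.
Fact hom_scale1 : left_id 1 hom_scale.
Proof. by move=> f; apply: hom_ext => u /=; rewrite scale1r. Qed.
Fact hom_scaleDr : right_distributive hom_scale +%R.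
Proof. by move=> a f g; apply: hom_ext => u /=; rewrite scalerDr. Qed.
Fact hom_scaleDl f : {morph hom_scale^~ f : a b / a + b}.
Proof. by move=> a b; apply: hom_ext => u /=; rewrite scalerDl. Qed.

HB.instance Definition _ := GRing.Zmodule_isLmodule.Build K (linmap U V)
  hom_scaleA hom_scale1 hom_scaleDr hom_scaleDl.

Lemma homD f g u : (f + g) u = f u + g u. Proof. by []. Qed.
Lemma homZ a f u : (a *: f) u = a *: f u. Proof. by []. Qed.
Lemma hom0 u : (0 : linmap U V) u = 0. Proof. by []. Qed.

End HomLmodule.

Fact hom_id_linear (U : lmodType K) : linear (@idfun U).
Proof. by []. Qed.
Definition hom_id (U : lmodType K) : linmap U U := mkhom (@hom_id_linear U).

Fact hom_comp_linear (U V W : lmodType K) (f : linmap V W) (g : linmap U V) :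
  linear (fun u => f (g u)).
Proof. by move=> a u v; rewrite !linearP. Qed.
Definition hom_comp (U V W : lmodType K) (f : linmap V W) (g : linmap U V) :
  linmap U W := mkhom (hom_comp_linear f g).

(* Bilinear maps V * W -> U are the elements of linmap V (linmap W U). *)
Section Bilinear.
Context (U V W : lmodType K) (B : V -> W -> U).
Hypotheses (Bl : forall w, linear (B^~ w)) (Br : forall v, linear (B v)).
Fact mkbil_subproof : linear (fun v => mkhom (Br v)).
Proof. by move=> a u v; apply: hom_ext => w /=; rewrite (Bl w). Qed.
Definition mkbil : linmap V (linmap W U) := mkhom mkbil_subproof.
Lemma mkbilE v w : mkbil v w = B v w. Proof. by []. Qed.
End Bilinear.

End Hom.

(* Unital associative K-algebras, with a bilinear product. Contrary to algType *)
(* the zero algebra is allowed: Hom(L, A) below is zero when L is.             *)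
HB.mixin Record isUnitalAlgebra (K : fieldType) A of GRing.Lmodule K A := {
  alg_one : A;
  alg_mul : linmap A (linmap A A);
  alg_mulA : forall a b c : A, alg_mul a (alg_mul b c) = alg_mul (alg_mul a b) c;
  alg_mul1l : forall a : A, alg_mul alg_one a = a;
  alg_mul1r : forall a : A, alg_mul a alg_one = a
}.
#[short(type="unitalAlgType")]
HB.structure Definition UnitalAlgebra (K : fieldType) :=
  {A of isUnitalAlgebra K A & GRing.Lmodule K A}.

Notation "a ⋆ b" := (alg_mul a b)
  (at level 40, left associativity) : tensor_scope.
Notation "'𝟙'" := (alg_one) (at level 0) : tensor_scope.
Local Open Scope tensor_scope.

Definition alg_morphism (K : fieldType) (A B : unitalAlgType K) (f : linmap A B) :=
  f 𝟙 = 𝟙 /\ forall a b, f (a ⋆ b) = f a ⋆ f b.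

Lemma alg_mulDl (K : fieldType) (A : unitalAlgType K) (a b c : A) :
  (a + b) ⋆ c = a ⋆ c + b ⋆ c.
Proof. by rewrite linearD. Qed.

Lemma alg_mulDr (K : fieldType) (A : unitalAlgType K) (a b c : A) :
  a ⋆ (b + c) = a ⋆ b + a ⋆ c.
Proof. exact: linearD. Qed.

Section RegularAlgebra.
Context (K : fieldType).
Fact regular_mul_linearl (b : K^o) : linear (fun a : K^o => a * b : K^o).
Proof. by move=> k u v; rewrite mulrDl -[k *: u]/(k * u) -mulrA. Qed.
Fact regular_mul_linearr (a : K^o) : linear (fun b : K^o => a * b : K^o).
Proof. by move=> k u v; rewrite mulrDr -[k *: u]/(k * u) mulrCA. Qed.
Definition regular_mul : linmap K^o (linmap K^o K^o) :=
  mkbil regular_mul_linearl regular_mul_linearr.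
HB.instance Definition _ := isUnitalAlgebra.Build K K^o
  (alg_mul := regular_mul) (@mulrA K) (@mul1r K) (@mulr1 K).
End RegularAlgebra.

Definition endo {K : fieldType} (U : lmodType K) := linmap U U.
Arguments endo {K} U%_type_scope.

Section Endo.
Context {K : fieldType} {U : lmodType K}.
HB.instance Definition _ := GRing.Lmodule.on (endo U).

Fact endo_mul_linearl (g : endo U) : linear (fun f : endo U => hom_comp f g : endo U).
Proof. by move=> k f h; apply: hom_ext. Qed.
Fact endo_mul_linearr (f : endo U) : linear (fun g : endo U => hom_comp f g : endo U).
Proof. by move=> k g h; apply: hom_ext => u /=; rewrite linearP. Qed.
Definition endo_mul : linmap (endo U) (linmap (endo U) (endo U)) :=
  mkbil endo_mul_linearl endo_mul_linearr.

Fact endo_mulA (f g h : endo U) :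
  endo_mul f (endo_mul g h) = endo_mul (endo_mul f g) h.
Proof. exact: hom_ext. Qed.
Fact endo_mul1l (f : endo U) : endo_mul (hom_id U) f = f.
Proof. exact: hom_ext. Qed.
Fact endo_mul1r (f : endo U) : endo_mul f (hom_id U) = f.
Proof. exact: hom_ext. Qed.

HB.instance Definition _ :=
  isUnitalAlgebra.Build K (endo U) endo_mulA endo_mul1l endo_mul1r.

Lemma endo_oneE u : (𝟙 : endo U) u = u. Proof. by []. Qed.
Lemma endo_mulE (f g : endo U) u : (f ⋆ g) u = f (g u). Proof. by []. Qed.
End Endo.

(* V (x) W: formal sums of pairs, two of them being identified when every     *)
(* bilinear map takes the same value on them.                                 *)
Section TensorProduct.
Context {K : fieldType} (V W : lmodType K).

Definition tens_eval (U : lmodType K) (B : linmap V (linmap W U))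
  (s : seq (V * W)) : U := \sum_(p <- s) B p.1 p.2.

Definition tens_rel (s t : seq (V * W)) : bool :=
  `[< forall (U : lmodType K) (B : linmap V (linmap W U)),
        tens_eval B s = tens_eval B t >].

Fact tens_rel_refl : reflexive tens_rel.
Proof. by move=> s; apply/asboolP. Qed.
Fact tens_rel_sym : symmetric tens_rel.
Proof.
by move=> s t; apply/asboolP/asboolP => st U B; rewrite st.
Qed.
Fact tens_rel_trans : transitive tens_rel.
Proof.
move=> s t u /asboolP ts /asboolP su; apply/asboolP => U B.
by rewrite ts.
Qed.

Canonical tens_equiv :=
  EquivRel tens_rel tens_rel_refl tens_rel_sym tens_rel_trans.

Definition tens := {eq_quot tens_equiv}.
HB.instance Definition _ := Choice.on tens.
HB.instance Definition _ := Quotient.on tens.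
HB.instance Definition _ := EqQuotient.on tens.

End TensorProduct.

Arguments tens {K} (V W)%_type_scope.
Notation "V ⊗ W" := (tens V W)
  (at level 40, left associativity) : type_scope.

Section TensorTheory.
Context {K : fieldType} {V W : lmodType K}.
Implicit Types (s t : V ⊗ W).

Definition tens_lift_fun (U : lmodType K) (B : linmap V (linmap W U)) (t : V ⊗ W) :=
  tens_eval B (repr t).

Lemma tens_lift_pi (U : lmodType K) (B : linmap V (linmap W U)) (s : seq (V * W)) :
  tens_lift_fun B (\pi_(V ⊗ W) s) = tens_eval B s.
Proof.
rewrite /tens_lift_fun; case: piP => t /eqmodP /= /asboolP st.
by rewrite (st U B).
Qed.

Lemma tens_eqP s t :
  (forall (U : lmodType K) (B : linmap V (linmap W U)),
     tens_lift_fun B s = tens_lift_fun B t) -> s = t.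
Proof.
move=> st; rewrite -(reprK s) -(reprK t); apply/eqmodP/asboolP => U B.
exact: st.
Qed.

Definition tens_zero : V ⊗ W := \pi_(V ⊗ W) [::].
Definition tens_opp s : V ⊗ W := \pi_(V ⊗ W) [seq (- p.1, p.2) | p <- repr s].
Definition tens_add s t : V ⊗ W := \pi_(V ⊗ W) (repr s ++ repr t).
Definition tens_scale (a : K) s : V ⊗ W := \pi_(V ⊗ W) [seq (a *: p.1, p.2) | p <- repr s].

Section Lift.
Context (U : lmodType K) (B : linmap V (linmap W U)).
Lemma tens_lift0 : tens_lift_fun B tens_zero = 0.
Proof. by rewrite tens_lift_pi /tens_eval big_nil. Qed.
Lemma tens_liftN s : tens_lift_fun B (tens_opp s) = - tens_lift_fun B s.
Proof.
rewrite tens_lift_pi /tens_eval big_map -sumrN.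
by apply: eq_bigr => p _; rewrite linearN.
Qed.
Lemma tens_liftD s t :
  tens_lift_fun B (tens_add s t) = tens_lift_fun B s + tens_lift_fun B t.
Proof. by rewrite tens_lift_pi /tens_eval big_cat. Qed.
Lemma tens_liftZ a s :
  tens_lift_fun B (tens_scale a s) = a *: tens_lift_fun B s.
Proof.
rewrite tens_lift_pi /tens_eval big_map scaler_sumr.
by apply: eq_bigr => p _; rewrite linearZ.
Qed.
End Lift.

Let liftE := (tens_lift0, tens_liftN, tens_liftD, tens_liftZ).

Fact tens_addA : associative tens_add.
Proof. by move=> s t u; apply: tens_eqP => U B; rewrite !liftE addrA. Qed.
Fact tens_addC : commutative tens_add.
Proof. by move=> s t; apply: tens_eqP => U B; rewrite !liftE addrC. Qed.
Fact tens_add0 : left_id tens_zero tens_add.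
Proof. by move=> s; apply: tens_eqP => U B; rewrite !liftE add0r. Qed.
Fact tens_addN : left_inverse tens_zero tens_opp tens_add.
Proof. by move=> s; apply: tens_eqP => U B; rewrite !liftE addNr. Qed.

HB.instance Definition _ :=
  GRing.isZmodule.Build (V ⊗ W) tens_addA tens_addC tens_add0 tens_addN.

Fact tens_scaleA a b s : tens_scale a (tens_scale b s) = tens_scale (a * b) s.
Proof. by apply: tens_eqP => U B; rewrite !liftE scalerA. Qed.
Fact tens_scale1 : left_id 1 tens_scale.
Proof. by move=> s; apply: tens_eqP => U B; rewrite !liftE scale1r. Qed.
Fact tens_scaleDr : right_distributive tens_scale +%R.
Proof. by move=> a s t; apply: tens_eqP => U B; rewrite !liftE scalerDr. Qed.
Fact tens_scaleDl s : {morph tens_scale^~ s : a b / a + b}.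
Proof. by move=> a b; apply: tens_eqP => U B; rewrite !liftE scalerDl. Qed.

HB.instance Definition _ := GRing.Zmodule_isLmodule.Build K (V ⊗ W)
  tens_scaleA tens_scale1 tens_scaleDr tens_scaleDl.

Fact tens_lift_linear (U : lmodType K) (B : linmap V (linmap W U)) :
  linear (tens_lift_fun B).
Proof. by move=> a s t; rewrite tens_liftD tens_liftZ. Qed.

Definition tens_pure_fun (v : V) (w : W) : V ⊗ W := \pi_(V ⊗ W) [:: (v, w)].

Lemma tens_lift_pure_fun (U : lmodType K) (B : linmap V (linmap W U)) v w :
  tens_lift_fun B (tens_pure_fun v w) = B v w.
Proof. by rewrite tens_lift_pi /tens_eval big_seq1. Qed.

Fact tens_pure_linearl w : linear (tens_pure_fun^~ w).
Proof.
move=> a u v; apply: tens_eqP => U B.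
by rewrite tens_liftD tens_liftZ !tens_lift_pure_fun linearP homD homZ.
Qed.
Fact tens_pure_linearr v : linear (tens_pure_fun v).
Proof.
move=> a u w; apply: tens_eqP => U B.
by rewrite tens_liftD tens_liftZ !tens_lift_pure_fun linearP.
Qed.

End TensorTheory.

HB.lock Definition tens_lift (K : fieldType) (V W U : lmodType K)
  (B : linmap V (linmap W U)) : linmap (V ⊗ W) U := mkhom (tens_lift_linear B).
HB.lock Definition tens_pure (K : fieldType) (V W : lmodType K) :
    linmap V (linmap W (V ⊗ W)) :=
  mkbil (@tens_pure_linearl K V W) (@tens_pure_linearr K V W).
Arguments tens_pure {K V W}.

Notation "v ⊗ w" := (tens_pure v w)
  (at level 40, left associativity) : tensor_scope.
Local Open Scope tensor_scope.

Section TensorUniversal.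
Context {K : fieldType} {V W : lmodType K}.

Lemma tens_lift_pure (U : lmodType K) (B : linmap V (linmap W U)) v w :
  tens_lift B (v ⊗ w) = B v w.
Proof. by rewrite tens_lift.unlock tens_pure.unlock; exact: tens_lift_pure_fun. Qed.

Lemma tens_pureDl (v v' : V) (w : W) : (v + v') ⊗ w = v ⊗ w + v' ⊗ w.
Proof. by rewrite linearD. Qed.

Lemma tens_ind (P : V ⊗ W -> Prop) :
  (forall v w, P (v ⊗ w)) -> (forall s t, P s -> P t -> P (s + t)) ->
  forall t, P t.
Proof.
move=> Ppure PD t; rewrite -(reprK t).
elim: (repr t) => [|[v w] s IHs].
  suff -> : \pi_(V ⊗ W) [::] = 0 ⊗ 0 by [].
  by rewrite linear0.
suff -> : \pi_(V ⊗ W) ((v, w) :: s) = v ⊗ w + \pi s by exact: PD.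
apply: tens_eqP => U B; rewrite tens_pure.unlock.
by rewrite tens_liftD !tens_lift_pi /tens_eval big_cons big_seq1.
Qed.

Lemma tens_hom_ext (U : lmodType K) (f g : linmap (V ⊗ W) U) :
  (forall v w, f (v ⊗ w) = g (v ⊗ w)) -> f = g.
Proof.
move=> fg; apply: hom_ext; elim/tens_ind => [//|s t].
by rewrite !linearD => -> ->.
Qed.

Fact tens_pure_linear (w : W) : linear (fun v : V => v ⊗ w).
Proof. by move=> a u v; rewrite linearP. Qed.

End TensorUniversal.

Lemma tens_hom_ext3 (K : fieldType) (V W X U : lmodType K) (f g : linmap ((V ⊗ W) ⊗ X) U) :
  (forall v w x, f ((v ⊗ w) ⊗ x) = g ((v ⊗ w) ⊗ x)) -> f = g.
Proof.
move=> fg; apply: tens_hom_ext => t x; move: t; apply: tens_ind => [//|s t fgs fgt].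
by rewrite !(linearD, homD) fgs fgt.
Qed.


Section TensorMap.
Context {K : fieldType} {V W V' W' : lmodType K} (f : linmap V V') (g : linmap W W').
Fact tens_map_linearl w : linear (fun v => f v ⊗ g w).
Proof. by move=> a u v; rewrite !linearP. Qed.
Fact tens_map_linearr v : linear (fun w => f v ⊗ g w).
Proof. by move=> a u w; rewrite !linearP. Qed.
End TensorMap.

HB.lock Definition tens_map (K : fieldType) (V W V' W' : lmodType K)
    (f : linmap V V') (g : linmap W W') : linmap (V ⊗ W) (V' ⊗ W') :=
  tens_lift (mkbil (tens_map_linearl f g) (tens_map_linearr f g)).

Section TensorMapTheory.
Context {K : fieldType} {V W V' W' : lmodType K}.
Lemma tens_map_pure (f : linmap V V') (g : linmap W W') v w :
  tens_map f g (v ⊗ w) = f v ⊗ g w.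
Proof. by rewrite tens_map.unlock tens_lift_pure. Qed.
Lemma tens_mapPl a (f f' : linmap V V') (g : linmap W W') :
  tens_map (a *: f + f') g = a *: tens_map f g + tens_map f' g.
Proof.
by apply: tens_hom_ext => v w; rewrite homD homZ !tens_map_pure linearP.
Qed.
Lemma tens_mapPr a (f : linmap V V') (g g' : linmap W W') :
  tens_map f (a *: g + g') = a *: tens_map f g + tens_map f g'.
Proof.
by apply: tens_hom_ext => v w; rewrite homD homZ !tens_map_pure linearP.
Qed.
End TensorMapTheory.

Section TensorAssoc.
Context {K : fieldType} {U V W : lmodType K}.
Fact tens_assoc3_linearl (w : W) (v : V) : linear (fun u : U => u ⊗ (v ⊗ w)).
Proof. by move=> a x y; rewrite linearP. Qed.
Fact tens_assoc3_linearr (w : W) (u : U) : linear (fun v : V => u ⊗ (v ⊗ w)).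
Proof. by move=> a x y; rewrite !linearP. Qed.
Definition tens_assoc3 (w : W) : linmap (U ⊗ V) (U ⊗ (V ⊗ W)) :=
  tens_lift (mkbil (tens_assoc3_linearl w) (tens_assoc3_linearr w)).
Fact tens_assoc3_linear : linear tens_assoc3.
Proof.
move=> a x y; apply: tens_hom_ext => u v.
by rewrite homD homZ !tens_lift_pure /= !linearP.
Qed.
Fact tens_assoc_linearl (w : W) : linear (fun t : U ⊗ V => tens_assoc3 w t).
Proof. exact: linearP. Qed.
Fact tens_assoc_linearr (t : U ⊗ V) : linear (fun w : W => tens_assoc3 w t).
Proof. by move=> a x y; rewrite tens_assoc3_linear. Qed.
End TensorAssoc.

HB.lock Definition tens_assoc (K : fieldType) (U V W : lmodType K) :
    linmap ((U ⊗ V) ⊗ W) (U ⊗ (V ⊗ W)) :=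
  tens_lift (mkbil (@tens_assoc_linearl K U V W) (@tens_assoc_linearr K U V W)).
Arguments tens_assoc {K U V W}.

Lemma tens_assoc_pure (K : fieldType) (U V W : lmodType K)
    (u : U) (v : V) (w : W) :
  tens_assoc ((u ⊗ v) ⊗ w) = u ⊗ (v ⊗ w).
Proof. by rewrite tens_assoc.unlock tens_lift_pure /= tens_lift_pure. Qed.

HB.mixin Record isCoalgebra (K : fieldType) C of GRing.Lmodule K C := {
  comult : linmap C (C ⊗ C);
  counit : linmap C K^o;
  comultA : forall c,
    tens_assoc (tens_map comult (hom_id C) (comult c)) =
    tens_map (hom_id C) comult (comult c);
  counitl : forall c, tens_map counit (hom_id C) (comult c) = (1 : K^o) ⊗ c;
  counitr : forall c, tens_map (hom_id C) counit (comult c) = c ⊗ (1 : K^o)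
}.
#[short(type="coalgType")]
HB.structure Definition Coalgebra (K : fieldType) :=
  {C of isCoalgebra K C & GRing.Lmodule K C}.
#[short(type="finCoalgType")]
HB.structure Definition FinCoalgebra (K : fieldType) :=
  {C of Coalgebra K C & Vector K C}.

Section Scaling.
Context {K : fieldType} {U V : lmodType K} (f : linmap U V).
Fact scaling_linearl u : linear (fun a : K^o => a *: f u).
Proof. by move=> k a b; rewrite scalerDl scalerA. Qed.
Fact scaling_linearr (a : K^o) : linear (fun u => a *: f u).
Proof. by move=> k u v; rewrite linearP scalerDr !scalerA mulrC. Qed.
Definition scalingl : linmap (K^o ⊗ U) V :=
  tens_lift (mkbil scaling_linearl scaling_linearr).
Definition scalingr : linmap (U ⊗ K^o) V :=
  tens_lift (mkbil scaling_linearr scaling_linearl).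
Lemma scalingl_pure a u : scalingl (a ⊗ u) = a *: f u.
Proof. by rewrite tens_lift_pure. Qed.
Lemma scalingr_pure a u : scalingr (u ⊗ a) = a *: f u.
Proof. by rewrite tens_lift_pure. Qed.
End Scaling.

(* Hom(C, A) with the convolution product f ⋆ g = mult (f ⊗ g) comult. *)
Definition conv {K : fieldType} (C : coalgType K) (A : unitalAlgType K) :=
  linmap C A.
Arguments conv {K} (C A)%_type_scope.

Section Convolution.
Context {K : fieldType} {C : coalgType K} {A : unitalAlgType K}.
Implicit Types f g h : conv C A.
HB.instance Definition _ := GRing.Lmodule.on (conv C A).

Definition conv_mul_hom f g : conv C A :=
  hom_comp (tens_lift alg_mul) (hom_comp (tens_map f g) comult).
Fact conv_one_linear : linear (fun c : C => (counit c : K) *: (𝟙 : A)).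
Proof. by move=> a u v; rewrite linearP scalerDl scalerA. Qed.
Definition conv_one : conv C A := mkhom conv_one_linear.

Fact conv_mul_linearl g : linear (conv_mul_hom^~ g).
Proof.
by move=> a f f'; apply: hom_ext => c /=; rewrite tens_mapPl linearP.
Qed.
Fact conv_mul_linearr f : linear (conv_mul_hom f).
Proof.
by move=> a g g'; apply: hom_ext => c /=; rewrite tens_mapPr linearP.
Qed.
Definition conv_mul : linmap (conv C A) (linmap (conv C A) (conv C A)) :=
  mkbil conv_mul_linearl conv_mul_linearr.

Fact conv_mulA f g h :
  conv_mul f (conv_mul g h) = conv_mul (conv_mul f g) h.
Proof.
pose m := tens_lift (@alg_mul K A).
have El : tens_map f (conv_mul g h) =
    hom_comp (tens_map f (hom_comp m (tens_map g h)))
             (tens_map (hom_id C) comult).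
  by apply: tens_hom_ext => u v; rewrite /= !tens_map_pure.
have Er : tens_map (conv_mul f g) h =
    hom_comp (tens_map (hom_comp m (tens_map f g)) h)
             (tens_map comult (hom_id C)).
  by apply: tens_hom_ext => u v; rewrite /= !tens_map_pure.
have E : hom_comp m (hom_comp (tens_map f (hom_comp m (tens_map g h))) tens_assoc)
    = hom_comp m (tens_map (hom_comp m (tens_map f g)) h).
  apply: tens_hom_ext3 => u v w; rewrite /= tens_assoc_pure !tens_map_pure /=.
  by rewrite !tens_map_pure !tens_lift_pure alg_mulA.
apply: hom_ext => c /=; rewrite El Er /= -comultA.
pose t := tens_map comult (hom_id C) (comult c).
exact: (congr1 (fun k : linmap ((C ⊗ C) ⊗ C) A => k t) E).
Qed.

Fact conv_mul1l f : conv_mul conv_one f = f.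
Proof.
have E : hom_comp (tens_lift alg_mul) (tens_map conv_one f) =
    hom_comp (scalingl f) (tens_map counit (hom_id C)).
  apply: tens_hom_ext => u v.
  rewrite /= !tens_map_pure tens_lift_pure scalingl_pure /=.
  by rewrite linearZ homZ alg_mul1l.
apply: hom_ext => c /=; have /= -> := congr1 (fun k : linmap _ _ => k (comult c)) E.
by rewrite counitl scalingl_pure scale1r.
Qed.
Fact conv_mul1r f : conv_mul f conv_one = f.
Proof.
have E : hom_comp (tens_lift alg_mul) (tens_map f conv_one) =
    hom_comp (scalingr f) (tens_map (hom_id C) counit).
  apply: tens_hom_ext => u v.
  rewrite /= !tens_map_pure tens_lift_pure scalingr_pure /=.
  by rewrite linearZ alg_mul1r.
apply: hom_ext => c /=; have /= -> := congr1 (fun k : linmap _ _ => k (comult c)) E.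
by rewrite counitr scalingr_pure scale1r.
Qed.

HB.instance Definition _ :=
  isUnitalAlgebra.Build K (conv C A) conv_mulA conv_mul1l conv_mul1r.

Lemma conv_oneE c : (𝟙 : conv C A) c = (counit c : K) *: 𝟙.
Proof. by []. Qed.
Lemma conv_mulE f g c :
  (f ⋆ g) c = tens_lift alg_mul (tens_map f g (comult c)).
Proof. by []. Qed.
End Convolution.

Section TensorAlgebraProduct.
Context {K : fieldType} {A B : unitalAlgType K}.

Fact tens_mul_linearl (b : B) :
  linear (fun a : A => tens_map (alg_mul a) (alg_mul b)).
Proof. by move=> k u v; rewrite linearP tens_mapPl. Qed.
Fact tens_mul_linearr (a : A) :
  linear (fun b : B => tens_map (alg_mul a) (alg_mul b)).
Proof. by move=> k u v; rewrite linearP tens_mapPr. Qed.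
End TensorAlgebraProduct.

HB.lock Definition tens_mul (K : fieldType) (A B : unitalAlgType K) :
    linmap (A ⊗ B) (linmap (A ⊗ B) (A ⊗ B)) :=
  tens_lift (mkbil (@tens_mul_linearl K A B) (@tens_mul_linearr K A B)).
Arguments tens_mul {K A B}.

Section TensorAlgebraProductTheory.
Context {K : fieldType} {A B : unitalAlgType K}.

Lemma tens_mul_pure (a a' : A) (b b' : B) :
  tens_mul (a ⊗ b) (a' ⊗ b') = (a ⋆ a') ⊗ (b ⋆ b').
Proof. by rewrite tens_mul.unlock tens_lift_pure /= tens_map_pure. Qed.

Fact tens_mulA (r s t : A ⊗ B) :
  tens_mul r (tens_mul s t) = tens_mul (tens_mul r s) t.
Proof.
move: r; apply: tens_ind => [a b|r r' IH IH']; last first.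
  by rewrite !(linearD, homD) IH IH'.
move: s; apply: tens_ind => [a' b'|r r' IH IH']; last first.
  by rewrite !(linearD, homD) IH IH'.
move: t; apply: tens_ind => [a'' b''|r r' IH IH']; last first.
  by rewrite !(linearD, homD) IH IH'.
by rewrite !tens_mul_pure !alg_mulA.
Qed.
Fact tens_mul1l (t : A ⊗ B) : tens_mul (𝟙 ⊗ 𝟙) t = t.
Proof.
move: t; apply: tens_ind => [a b|r r' IH IH'].
  by rewrite tens_mul_pure !alg_mul1l.
by rewrite linearD IH IH'.
Qed.
Fact tens_mul1r (t : A ⊗ B) : tens_mul t (𝟙 ⊗ 𝟙) = t.
Proof.
move: t; apply: tens_ind => [a b|r r' IH IH'].
  by rewrite tens_mul_pure !alg_mul1r.
by rewrite linearD homD IH IH'.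
Qed.

HB.instance Definition _ :=
  isUnitalAlgebra.Build K (A ⊗ B)%type tens_mulA tens_mul1l tens_mul1r.

Lemma tens_oneE : (𝟙 : A ⊗ B) = 𝟙 ⊗ 𝟙. Proof. by []. Qed.
Lemma tens_mulE (a a' : A) (b b' : B) :
  (a ⊗ b) ⋆ (a' ⊗ b') = (a ⋆ a') ⊗ (b ⋆ b').
Proof. exact: tens_mul_pure. Qed.

Lemma tens_alg_morphism (D : unitalAlgType K) (f : linmap (A ⊗ B) D) :
  f (𝟙 ⊗ 𝟙) = 𝟙 ->
  (forall a b a' b', f ((a ⋆ a') ⊗ (b ⋆ b')) = f (a ⊗ b) ⋆ f (a' ⊗ b')) ->
  alg_morphism f.
Proof.
move=> f1 fM; split=> [//|s t].
move: s; apply: tens_ind => [a b|r r' IH IH']; last first.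
  by rewrite !(linearD, homD) IH IH'.
move: t; apply: tens_ind => [a' b'|r r' IH IH']; last first.
  by rewrite !(linearD, homD) IH IH'.
by rewrite tens_mulE fM.
Qed.

End TensorAlgebraProductTheory.

Section AlgMorphism.
Context {K : fieldType}.

Lemma alg_morphism_comp (A B D : unitalAlgType K) (f : linmap B D) (g : linmap A B) :
  alg_morphism f -> alg_morphism g -> alg_morphism (hom_comp f g).
Proof.
by move=> [f1 fM] [g1 gM]; split=> [|a b] /=; rewrite ?g1 ?gM.
Qed.

Lemma tens_map_morphism (A B A' B' : unitalAlgType K)
    (f : linmap A A') (g : linmap B B') :
  alg_morphism f -> alg_morphism g -> alg_morphism (tens_map f g).
Proof.
move=> [f1 fM] [g1 gM]; apply: tens_alg_morphism => [|a b a' b'].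
  by rewrite tens_map_pure f1 g1.
by rewrite !tens_map_pure fM gM tens_mulE.
Qed.

Lemma hom_id_morphism (A : unitalAlgType K) : alg_morphism (hom_id A).
Proof. by []. Qed.

Lemma tens_alg_morphism3 (A B D E : unitalAlgType K) (f : linmap ((A ⊗ B) ⊗ D) E) :
  f ((𝟙 ⊗ 𝟙) ⊗ 𝟙) = 𝟙 ->
  (forall a b d a' b' d', f (((a ⋆ a') ⊗ (b ⋆ b')) ⊗ (d ⋆ d')) =
     f ((a ⊗ b) ⊗ d) ⋆ f ((a' ⊗ b') ⊗ d')) ->
  alg_morphism f.
Proof.
move=> f1 fM; apply: tens_alg_morphism => [//|s d s' d'].
move: s; apply: tens_ind => [a b|r r' IH IH'].
  move: s'; apply: tens_ind => [a' b'|r r' IH IH']; first by rewrite tens_mulE.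
  by rewrite alg_mulDr !tens_pureDl !(linearD f) IH IH' alg_mulDr.
by rewrite alg_mulDl !tens_pureDl !(linearD f) IH IH' alg_mulDl.
Qed.

Lemma tens_assoc_morphism (A B D : unitalAlgType K) :
  alg_morphism (@tens_assoc K A B D).
Proof.
apply: tens_alg_morphism3 => [|a b d a' b' d'].
  by rewrite tens_assoc_pure.
by rewrite !tens_assoc_pure !tens_mulE.
Qed.

End AlgMorphism.

(* T(V): formal linear combinations of words, two of them being identified    *)
(* when they have the same value under every linear map from V to an algebra. *)
Section TensorAlgebra.
Context {K : fieldType} (V : lmodType K).

Definition word_eval (A : unitalAlgType K) (f : linmap V A) (w : seq V) : A :=
  foldr (fun v a => f v ⋆ a) 𝟙 w.

Definition tensalg_eval (A : unitalAlgType K) (f : linmap V A)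
  (s : seq (K * seq V)) : A := \sum_(p <- s) p.1 *: word_eval f p.2.

Definition tensalg_rel (s t : seq (K * seq V)) : bool :=
  `[< forall (A : unitalAlgType K) (f : linmap V A),
        tensalg_eval f s = tensalg_eval f t >].

Fact tensalg_rel_refl : reflexive tensalg_rel.
Proof. by move=> s; apply/asboolP. Qed.
Fact tensalg_rel_sym : symmetric tensalg_rel.
Proof. by move=> s t; apply/asboolP/asboolP => st A f; rewrite st. Qed.
Fact tensalg_rel_trans : transitive tensalg_rel.
Proof.
move=> s t u /asboolP ts /asboolP su; apply/asboolP => A f.
by rewrite ts.
Qed.

Canonical tensalg_equiv :=
  EquivRel tensalg_rel tensalg_rel_refl tensalg_rel_sym tensalg_rel_trans.

Definition tensalg := {eq_quot tensalg_equiv}.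
HB.instance Definition _ := Choice.on tensalg.
HB.instance Definition _ := Quotient.on tensalg.
HB.instance Definition _ := EqQuotient.on tensalg.

End TensorAlgebra.
Arguments tensalg {K} V%_type_scope.

Section TensorAlgebraTheory.
Context {K : fieldType} {V : lmodType K}.
Local Notation T := (tensalg V).
Implicit Types s t : T.

Definition tensalg_lift_fun (A : unitalAlgType K) (f : linmap V A) (t : T) : A :=
  tensalg_eval f (repr t).

Lemma tensalg_lift_pi (A : unitalAlgType K) (f : linmap V A) (s : seq (K * seq V)) :
  tensalg_lift_fun f (\pi_T s) = tensalg_eval f s.
Proof.
rewrite /tensalg_lift_fun; case: piP => t /eqmodP /= /asboolP st.
by rewrite (st A f).
Qed.

Lemma tensalg_eqP s t :
  (forall (A : unitalAlgType K) (f : linmap V A),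
     tensalg_lift_fun f s = tensalg_lift_fun f t) -> s = t.
Proof.
move=> st; rewrite -(reprK s) -(reprK t); apply/eqmodP/asboolP => A f.
exact: st.
Qed.

Definition tensalg_zero : T := \pi_T [::].
Definition tensalg_opp s : T := \pi_T [seq (- p.1, p.2) | p <- repr s].
Definition tensalg_add s t : T := \pi_T (repr s ++ repr t).
Definition tensalg_scale (a : K) s : T :=
  \pi_T [seq (a * p.1, p.2) | p <- repr s].
Definition tensalg_one : T := \pi_T [:: (1, [::])].
Definition tensalg_mul_fun s t : T :=
  \pi_T [seq (p.1 * q.1, p.2 ++ q.2) | p <- repr s, q <- repr t].

Section Lift.
Context (A : unitalAlgType K) (f : linmap V A).
Local Notation lift := (tensalg_lift_fun f).

Lemma tensalg_lift0 : lift tensalg_zero = 0.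
Proof. by rewrite tensalg_lift_pi /tensalg_eval big_nil. Qed.
Lemma tensalg_liftN s : lift (tensalg_opp s) = - lift s.
Proof.
rewrite tensalg_lift_pi /tensalg_eval big_map -sumrN.
by apply: eq_bigr => p _; rewrite scaleNr.
Qed.
Lemma tensalg_liftD s t : lift (tensalg_add s t) = lift s + lift t.
Proof. by rewrite tensalg_lift_pi /tensalg_eval big_cat. Qed.
Lemma tensalg_liftZ a s : lift (tensalg_scale a s) = a *: lift s.
Proof.
rewrite tensalg_lift_pi /tensalg_eval big_map scaler_sumr.
by apply: eq_bigr => p _; rewrite scalerA.
Qed.
Lemma tensalg_lift1 : lift tensalg_one = 𝟙.
Proof. by rewrite tensalg_lift_pi /tensalg_eval big_seq1 scale1r. Qed.
Lemma word_eval_cat w w' :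
  word_eval f (w ++ w') = word_eval f w ⋆ word_eval f w'.
Proof.
by elim: w => [|v w IHw] /=; rewrite ?alg_mul1l // IHw alg_mulA.
Qed.
Lemma tensalg_liftM s t : lift (tensalg_mul_fun s t) = lift s ⋆ lift t.
Proof.
rewrite tensalg_lift_pi /tensalg_eval big_allpairs_dep /=.
rewrite /tensalg_lift_fun /tensalg_eval.
elim: (repr s) => [|p r IHr]; first by rewrite !big_nil linear0.
rewrite !big_cons IHr linearD homD linearZ homZ; congr (_ + _).
rewrite linear_sum scaler_sumr; apply: eq_bigr => q _.
by rewrite word_eval_cat linearZ /= scalerA.
Qed.
End Lift.

Let liftE := (tensalg_lift0, tensalg_liftN, tensalg_liftD, tensalg_liftZ,
  tensalg_lift1, tensalg_liftM).

Fact tensalg_addA : associative tensalg_add.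
Proof. by move=> s t u; apply: tensalg_eqP => A f; rewrite !liftE addrA. Qed.
Fact tensalg_addC : commutative tensalg_add.
Proof. by move=> s t; apply: tensalg_eqP => A f; rewrite !liftE addrC. Qed.
Fact tensalg_add0 : left_id tensalg_zero tensalg_add.
Proof. by move=> s; apply: tensalg_eqP => A f; rewrite !liftE add0r. Qed.
Fact tensalg_addN : left_inverse tensalg_zero tensalg_opp tensalg_add.
Proof. by move=> s; apply: tensalg_eqP => A f; rewrite !liftE addNr. Qed.

HB.instance Definition _ := GRing.isZmodule.Build T
  tensalg_addA tensalg_addC tensalg_add0 tensalg_addN.

Fact tensalg_scaleA a b s :
  tensalg_scale a (tensalg_scale b s) = tensalg_scale (a * b) s.
Proof. by apply: tensalg_eqP => A f; rewrite !liftE scalerA. Qed.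
Fact tensalg_scale1 : left_id 1 tensalg_scale.
Proof. by move=> s; apply: tensalg_eqP => A f; rewrite !liftE scale1r. Qed.
Fact tensalg_scaleDr : right_distributive tensalg_scale +%R.
Proof.
by move=> a s t; apply: tensalg_eqP => A f; rewrite !liftE scalerDr.
Qed.
Fact tensalg_scaleDl s : {morph tensalg_scale^~ s : a b / a + b}.
Proof.
by move=> a b; apply: tensalg_eqP => A f; rewrite !liftE scalerDl.
Qed.

HB.instance Definition _ := GRing.Zmodule_isLmodule.Build K T
  tensalg_scaleA tensalg_scale1 tensalg_scaleDr tensalg_scaleDl.

Fact tensalg_mul_linearl t : linear (tensalg_mul_fun^~ t).
Proof.
by move=> a s u; apply: tensalg_eqP => A f; rewrite !liftE linearP homD homZ.
Qed.
Fact tensalg_mul_linearr s : linear (tensalg_mul_fun s).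
Proof.
by move=> a t u; apply: tensalg_eqP => A f; rewrite !liftE linearP.
Qed.
End TensorAlgebraTheory.

HB.lock Definition tensalg_mul (K : fieldType) (V : lmodType K) :
    linmap (tensalg V) (linmap (tensalg V) (tensalg V)) :=
  mkbil (@tensalg_mul_linearl K V) (@tensalg_mul_linearr K V).
Arguments tensalg_mul {K V}.

Section TensorAlgebraInstance.
Context {K : fieldType} {V : lmodType K}.
Local Notation T := (tensalg V).
Implicit Types s t : T.

Lemma tensalg_lift_mul (A : unitalAlgType K) (f : linmap V A) s t :
  tensalg_lift_fun f (tensalg_mul s t) =
  tensalg_lift_fun f s ⋆ tensalg_lift_fun f t.
Proof. by rewrite tensalg_mul.unlock; exact: tensalg_liftM. Qed.

Fact tensalg_mulA s t u :
  tensalg_mul s (tensalg_mul t u) = tensalg_mul (tensalg_mul s t) u.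
Proof. by apply: tensalg_eqP => A f; rewrite !(tensalg_lift_mul, tensalg_lift1) alg_mulA. Qed.
Fact tensalg_mul1l s : tensalg_mul tensalg_one s = s.
Proof. by apply: tensalg_eqP => A f; rewrite !(tensalg_lift_mul, tensalg_lift1) alg_mul1l. Qed.
Fact tensalg_mul1r s : tensalg_mul s tensalg_one = s.
Proof. by apply: tensalg_eqP => A f; rewrite !(tensalg_lift_mul, tensalg_lift1) alg_mul1r. Qed.

HB.instance Definition _ :=
  isUnitalAlgebra.Build K T tensalg_mulA tensalg_mul1l tensalg_mul1r.

Fact tensalg_lift_linear (A : unitalAlgType K) (f : linmap V A) :
  linear (tensalg_lift_fun f).
Proof. by move=> a s t; rewrite tensalg_liftD tensalg_liftZ. Qed.

Definition tensalg_inj_fun (v : V) : T := \pi_T [:: (1, [:: v])].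
Lemma tensalg_lift_inj_fun (A : unitalAlgType K) (f : linmap V A) v :
  tensalg_lift_fun f (tensalg_inj_fun v) = f v.
Proof.
by rewrite tensalg_lift_pi /tensalg_eval big_seq1 scale1r /= alg_mul1r.
Qed.
Fact tensalg_inj_linear : linear tensalg_inj_fun.
Proof.
move=> a u v; apply: tensalg_eqP => A f.
by rewrite tensalg_liftD tensalg_liftZ !tensalg_lift_inj_fun linearP.
Qed.
End TensorAlgebraInstance.

HB.lock Definition tensalg_inj (K : fieldType) (V : lmodType K) :
  linmap V (tensalg V) := mkhom (@tensalg_inj_linear K V).
Arguments tensalg_inj {K V}.
HB.lock Definition tensalg_lift (K : fieldType) (V : lmodType K)
    (A : unitalAlgType K) (f : linmap V A) : linmap (tensalg V) A :=
  mkhom (tensalg_lift_linear f).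

Section TensorAlgebraUniversal.
Context {K : fieldType} {V : lmodType K} {A : unitalAlgType K}.

Lemma tensalg_lift_inj (f : linmap V A) v : tensalg_lift f (tensalg_inj v) = f v.
Proof.
rewrite tensalg_lift.unlock tensalg_inj.unlock; exact: tensalg_lift_inj_fun.
Qed.

Lemma tensalg_lift_morphism (f : linmap V A) : alg_morphism (tensalg_lift f).
Proof.
rewrite tensalg_lift.unlock; split; first exact: tensalg_lift1.
exact: tensalg_lift_mul.
Qed.

End TensorAlgebraUniversal.

Section TensorAlgebraInduction.
Context {K : fieldType} {V : lmodType K}.

Lemma tensalg_reprE (t : tensalg V) : t = tensalg_eval tensalg_inj (repr t).
Proof.
apply: tensalg_eqP => A f; rewrite {1}/tensalg_lift_fun.
have [f1 fM] := tensalg_lift_morphism f.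
have -> : tensalg_lift_fun f = tensalg_lift f by rewrite tensalg_lift.unlock.
rewrite /tensalg_eval linear_sum; apply: eq_bigr => p _; rewrite linearZ.
congr (_ *: _); elim: p.2 => [|v w IHw] /=; first by rewrite f1.
by rewrite fM IHw tensalg_lift_inj.
Qed.

Lemma tensalg_ind (P : tensalg V -> Prop) :
  P 𝟙 -> (forall v t, P t -> P (tensalg_inj v ⋆ t)) ->
  (forall a s t, P s -> P t -> P (a *: s + t)) -> forall t, P t.
Proof.
move=> P1 PM PL t; have P0 : P 0 by rewrite -(addNr 𝟙) -scaleN1r; exact: PL.
rewrite (tensalg_reprE t) /tensalg_eval.
elim: {t}(repr t) => [|[a w] s IHs]; first by rewrite big_nil.
rewrite big_cons; apply: PL => //=.
by elim: w => [//|v w IHw] /=; exact: PM.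
Qed.

Lemma tensalg_hom_ext (A : unitalAlgType K) (f g : linmap (tensalg V) A) :
  alg_morphism f -> alg_morphism g ->
  (forall v, f (tensalg_inj v) = g (tensalg_inj v)) -> f = g.
Proof.
move=> [f1 fM] [g1 gM] fg; apply: hom_ext.
apply: tensalg_ind => [|v t IHt|a s t IHs IHt]; first by rewrite f1 g1.
  by rewrite fM gM fg IHt.
by rewrite !linearP IHs IHt.
Qed.

End TensorAlgebraInduction.

Section TensorMapComposition.
Context {K : fieldType}.

Lemma tens_map_comp (U V W U' V' W' : lmodType K) (f : linmap V W) (f' : linmap V' W')
    (g : linmap U V) (g' : linmap U' V') t :
  tens_map f f' (tens_map g g' t) = tens_map (hom_comp f g) (hom_comp f' g') t.
Proof.
suff E : hom_comp (tens_map f f') (tens_map g g') =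
    tens_map (hom_comp f g) (hom_comp f' g') by rewrite -E.
by apply: tens_hom_ext => u u'; rewrite /= !tens_map_pure.
Qed.

Lemma tens_assoc_map (U V W U' V' W' : lmodType K)
    (f : linmap U U') (g : linmap V V') (h : linmap W W') t :
  tens_assoc (tens_map (tens_map f g) h t) =
  tens_map f (tens_map g h) (tens_assoc t).
Proof.
suff E : hom_comp tens_assoc (tens_map (tens_map f g) h) =
    hom_comp (tens_map f (tens_map g h)) tens_assoc.
  exact: (congr1 (fun k : linmap _ _ => k t) E).
apply: tens_hom_ext3 => u v w.
by rewrite /= tens_assoc_pure !tens_map_pure tens_assoc_pure.
Qed.
End TensorMapComposition.

Section TensorBialgebra.
Context {K : fieldType} {L : coalgType K}.
Local Notation T := (tensalg L).
Local Notation ι := (@tensalg_inj K L).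

Definition tensalg_comult : linmap T (T ⊗ T) :=
  tensalg_lift (hom_comp (tens_map ι ι) comult).
Definition tensalg_counit : linmap T K^o := tensalg_lift (counit : linmap L K^o).

Lemma tensalg_comult_inj l : tensalg_comult (ι l) = tens_map ι ι (comult l).
Proof. by rewrite tensalg_lift_inj. Qed.
Lemma tensalg_comult_morphism : alg_morphism tensalg_comult.
Proof. exact: tensalg_lift_morphism. Qed.
Lemma tensalg_counit_inj l : tensalg_counit (ι l) = counit l.
Proof. by rewrite tensalg_lift_inj. Qed.
Lemma tensalg_counit_morphism : alg_morphism tensalg_counit.
Proof. exact: tensalg_lift_morphism. Qed.

Let comult_injE : hom_comp tensalg_comult ι = hom_comp (tens_map ι ι) comult.
Proof. by apply: hom_ext => l; rewrite /= tensalg_comult_inj. Qed.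
Let counit_injE : hom_comp tensalg_counit ι = counit.
Proof. by apply: hom_ext => l; rewrite /= tensalg_counit_inj. Qed.

Fact tensalg_comultA t :
  tens_assoc (tens_map tensalg_comult (hom_id T) (tensalg_comult t)) =
  tens_map (hom_id T) tensalg_comult (tensalg_comult t).
Proof.
suff E : hom_comp tens_assoc
      (hom_comp (tens_map tensalg_comult (hom_id T)) tensalg_comult) =
    hom_comp (tens_map (hom_id T) tensalg_comult) tensalg_comult.
  exact: (congr1 (fun k : linmap _ _ => k t) E).
apply: tensalg_hom_ext.
- apply: alg_morphism_comp (@tens_assoc_morphism _ _ _ _) _.
  apply: alg_morphism_comp tensalg_comult_morphism.
  exact: tens_map_morphism tensalg_comult_morphism (hom_id_morphism _).
- apply: alg_morphism_comp tensalg_comult_morphism.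
  exact: tens_map_morphism (hom_id_morphism _) tensalg_comult_morphism.
move=> l; rewrite /= tensalg_comult_inj !tens_map_comp comult_injE.
have -> : hom_comp (hom_id T) ι = hom_comp ι (hom_id L) by exact: hom_ext.
rewrite -[LHS]/(tens_assoc _) -!tens_map_comp.
by rewrite tens_assoc_map comultA.
Qed.

Fact tensalg_counitl t :
  tens_map tensalg_counit (hom_id T) (tensalg_comult t) = (1 : K^o) ⊗ t.
Proof.
suff E : hom_comp (tens_map tensalg_counit (hom_id T)) tensalg_comult =
    tens_pure (1 : K^o).
  exact: (congr1 (fun k : linmap _ _ => k t) E).
apply: tensalg_hom_ext.
- apply: alg_morphism_comp tensalg_comult_morphism.
  exact: tens_map_morphism tensalg_counit_morphism (hom_id_morphism _).
- by split=> [//|a b]; rewrite tens_mulE [in RHS]alg_mul1l.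
move=> l; rewrite /= tensalg_comult_inj tens_map_comp counit_injE.
have -> : counit = hom_comp (hom_id K^o) (@counit K L) by exact: hom_ext.
have -> : hom_comp (hom_id T) ι = hom_comp ι (hom_id L) by exact: hom_ext.
by rewrite -tens_map_comp counitl tens_map_pure.
Qed.

Fact tensalg_counitr t :
  tens_map (hom_id T) tensalg_counit (tensalg_comult t) = t ⊗ (1 : K^o).
Proof.
pose r : linmap T (T ⊗ K^o) := mkhom (@tens_pure_linear K T K^o 1).
suff E : hom_comp (tens_map (hom_id T) tensalg_counit) tensalg_comult = r.
  exact: (congr1 (fun k : linmap _ _ => k t) E).
apply: tensalg_hom_ext.
- apply: alg_morphism_comp tensalg_comult_morphism.
  exact: tens_map_morphism (hom_id_morphism _) tensalg_counit_morphism.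
- by split=> [//|a b]; rewrite /= tens_mulE alg_mul1l.
move=> l; rewrite /= tensalg_comult_inj tens_map_comp counit_injE.
have -> : counit = hom_comp (hom_id K^o) (@counit K L) by exact: hom_ext.
have -> : hom_comp (hom_id T) ι = hom_comp ι (hom_id L) by exact: hom_ext.
by rewrite -tens_map_comp counitr tens_map_pure.
Qed.

HB.instance Definition _ := isCoalgebra.Build K T
  tensalg_comultA tensalg_counitl tensalg_counitr.

End TensorBialgebra.

Section Invariant.
Context {K : fieldType} (C : coalgType K).

Definition Invd : set (endo C) :=
  [set A : endo C | forall c : C, comult (A c) = tens_map A (hom_id C) (comult c)].
End Invariant.
Arguments Invd {K} C%_type_scope _.

Section TensorOperators.
Context {K : fieldType} {L F : coalgType K}.
Context (x : linmap L (endo F)).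
Local Notation T := (tensalg F).
Local Notation ι := tensalg_inj.

Fact tensor_gen_linearl l : linear (fun f : F => ι (x l f)).
Proof. by move=> a u v; rewrite !linearP. Qed.
Fact tensor_gen_linearr f : linear (fun l : L => ι (x l f)).
Proof. by move=> a u v; rewrite linearP homD homZ linearP. Qed.
Definition tensor_gen : linmap F (conv L T) :=
  mkbil tensor_gen_linearl tensor_gen_linearr.

(* The three conditions determining X say that w |-> (l |-> X(l)(w)) is the   *)
(* morphism T(F) -> Hom(L, T(F)) of unital algebras extending f |-> x(.)(f).  *)
Definition tensor_conv : linmap T (conv L T) := tensalg_lift tensor_gen.

Fact tensor_op_linearl w : linear (fun l : L => tensor_conv w l).
Proof. exact: linearP. Qed.
Fact tensor_op_linearr l : linear (fun w : T => tensor_conv w l).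
Proof. by move=> a u v; rewrite linearP. Qed.
Definition tensor_op : linmap L (endo T) := mkbil tensor_op_linearl tensor_op_linearr.

Lemma tensor_op1 l : tensor_op l 𝟙 = (counit l : K) *: 𝟙.
Proof.
by rewrite mkbilE; have [-> _] := tensalg_lift_morphism tensor_gen.
Qed.
Lemma tensor_op_inj l f : tensor_op l (ι f) = ι (x l f).
Proof. by rewrite mkbilE /tensor_conv tensalg_lift_inj. Qed.
Lemma tensor_opM l w1 w2 : tensor_op l (w1 ⋆ w2) =
  tens_lift alg_mul (tens_map (tensor_conv w1) (tensor_conv w2) (comult l)).
Proof.
by rewrite mkbilE; have [_ ->] := tensalg_lift_morphism tensor_gen.
Qed.

Definition tensor_rep : linmap (tensalg L) (endo T) := tensalg_lift tensor_op.

Lemma tensor_rep_inj l : tensor_rep (ι l) = tensor_op l.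
Proof. exact: tensalg_lift_inj. Qed.
Lemma tensor_rep_morphism : alg_morphism tensor_rep.
Proof. exact: tensalg_lift_morphism. Qed.

End TensorOperators.

Section TensorOperatorsInvariant.
Context {K : fieldType} {L F : coalgType K} (x : linmap L (endo F)).
Local Notation T := (tensalg F).
Local Notation ι := tensalg_inj.

(* t |-> (l |-> (X(l) ⊗ id)(t)) *)
Fact tensor_conv2_linearl t :
  linear (fun l : L => tens_map (tensor_op x l) (hom_id T) t).
Proof. by move=> a u v; rewrite linearP tens_mapPl homD homZ. Qed.
Fact tensor_conv2_linearr l :
  linear (fun t : T ⊗ T => tens_map (tensor_op x l) (hom_id T) t).
Proof. exact: linearP. Qed.
Definition tensor_conv2 : linmap (T ⊗ T) (conv L (T ⊗ T)) :=
  mkbil tensor_conv2_linearr tensor_conv2_linearl.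

Lemma tensor_conv2_morphism : alg_morphism tensor_conv2.
Proof.
apply: tens_alg_morphism => [|a b a' b'].
  by apply: hom_ext => l; rewrite /= tens_map_pure tensor_op1 linearZ.
apply: hom_ext => l; rewrite conv_mulE /= tens_map_pure tensor_opM.
move: (comult l) => t; move: t; apply: tens_ind => [l1 l2|s t IHs IHt].
  rewrite !tens_map_pure !tens_lift_pure /= !tens_map_pure.
  by rewrite tens_mulE.
rewrite !(linearD (tens_map _ _)) !(linearD (tens_lift _)) tens_pureDl.
by rewrite IHs IHt.
Qed.

Lemma tensor_op_Invd :
  (forall l, Invd F (x l)) -> forall l, Invd T (tensor_op x l).
Proof.
move=> xinv l w.
pose post : linmap T (conv L (T ⊗ T)) :=
  mkbil (fun l => linearP (hom_comp tensalg_comult (tensor_op x l)))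
        (fun w => linearP (hom_comp tensalg_comult (tensor_conv x w))).
suff E : post = hom_comp tensor_conv2 tensalg_comult.
  have Ew : post w l = hom_comp tensor_conv2 tensalg_comult w l by rewrite E.
  rewrite -[LHS]/(post w l) Ew; reflexivity.
have [D1 DM] := @tensalg_comult_morphism K F.
apply: tensalg_hom_ext.
- split=> [|w1 w2]; apply: hom_ext => {}l.
    rewrite -[LHS]/(tensalg_comult (tensor_op x l 𝟙)) tensor_op1 linearZ /= D1.
    by [].
  rewrite -[LHS]/(tensalg_comult (tensor_op x l (w1 ⋆ w2))) tensor_opM conv_mulE.
  move: (comult l) => t; move: t; apply: tens_ind => [l1 l2|s t IHs IHt].
    by rewrite !tens_map_pure !tens_lift_pure DM.
  rewrite !(linearD (tens_map _ _)) !(linearD (tens_lift _)).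
  by rewrite (linearD tensalg_comult) IHs IHt.
- exact: alg_morphism_comp tensor_conv2_morphism (@tensalg_comult_morphism _ _).
move=> f; apply: hom_ext => {}l.
rewrite -[LHS]/(tensalg_comult (tensor_op x l (ι f))).
rewrite -[RHS]/(tens_map (tensor_op x l) (hom_id T) (tensalg_comult (ι f))).
rewrite tensor_op_inj !tensalg_comult_inj xinv !tens_map_comp.
have -> : hom_comp (tensor_op x l) ι = hom_comp ι (x l).
  by apply: hom_ext => u; exact: tensor_op_inj.
by have -> : hom_comp (hom_id T) ι = hom_comp ι (hom_id F) by exact: hom_ext.
Qed.

Lemma tensor_rep_Invd :
  (forall l, Invd F (x l)) -> forall w, Invd T (tensor_rep x w).
Proof.
move=> xinv; have [r1 rM] := tensor_rep_morphism x.
apply: tensalg_ind => [t|l w IHw t|a v w IHv IHw t].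
- rewrite r1 -[LHS]/(comult t); suff -> : tens_map (𝟙 : endo T) (hom_id T) =
    hom_id (T ⊗ T)%type by [].
  by apply: tens_hom_ext => u v; rewrite tens_map_pure.
- rewrite rM endo_mulE tensor_rep_inj (tensor_op_Invd xinv l) IHw tens_map_comp.
  by congr (tens_map _ _ _); apply: hom_ext.
rewrite linearP homD homZ linearP IHv IHw.
by rewrite tens_mapPl homD homZ.
Qed.
End TensorOperatorsInvariant.

Section Subspaces.
Context {K : fieldType}.

Definition linsubspace (V : lmodType K) (S : set V) :=
  S 0 /\ forall (a : K) u v, S u -> S v -> S (a *: u + v).

Definition lspan (V : lmodType K) (G : set V) : set V := smallest (@linsubspace V) G.

Definition finite_dim (V : lmodType K) (S : set V) :=
  exists s : seq V, S = lspan [set v | v \in s].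

Definition sum_set (V : lmodType K) (S S' : set V) : set V :=
  [set u + v | u in S & v in S'].

Definition tens_set (V W : lmodType K) (S : set V) (S' : set W) : set (V ⊗ W) :=
  lspan [set v ⊗ w | v in S & w in S'].

Definition subcoalgebra (D : coalgType K) (C : set D) :=
  linsubspace C /\ forall c, C c -> tens_set C C (comult c).

(* I is a coideal of the subcoalgebra C of D; I ⊗ C and C ⊗ I, which embed in *)
(* D ⊗ D since K is a field, are taken there.                                *)
Definition coideal (D : coalgType K) (C I : set D) :=
  [/\ linsubspace I, I `<=` C,
      forall c, I c -> sum_set (tens_set I C) (tens_set C I) (comult c) &
      forall c, I c -> counit c = 0].

(* The largest coideal of C contained in S, not only a maximal element. *)
Definition maximal_coideal_in (D : coalgType K) (C S J : set D) :=
  [/\ coideal C J, J `<=` S &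
      forall I, coideal C I -> I `<=` S -> I `<=` J].

End Subspaces.

Section Relations.
Context {K : fieldType} {L F : coalgType K} (x : linmap L (endo F)).

Definition relations (C : set (tensalg L)) : set (tensalg L) :=
  C `&` [set w | tensor_rep x w = 0].

Definition minimal_space : set (tensalg F) :=
  [set a *: 𝟙 + tensalg_inj f | a in [set: K] & f in [set: F]].

Definition minimal_relations (C : set (tensalg L)) : set (tensalg L) :=
  C `&` [set w | forall u, minimal_space u -> tensor_rep x w u = 0].

End Relations.

(* Main.v *)
Require Import Defs.
From mathcomp Require Import all_boot all_algebra.
From mathcomp Require Import boolp classical_sets reals complex.

(* The counit of T(F) being multiplicative, the pairing                       *)
(* <w, u> = ε(π_x(w)(u)) of T(L) with T(F) satisfies                          *)
(* <w, u v> = Σ <w', u> <w'', v>, and <w, 1> is the counit of w.              *)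
(* A right-invariant operator A is determined by ε ∘ A, so that the relations *)
(* in C form the left radical R of this pairing on C; since C has finite      *)
(* dimension, an element of C ⊗ C killed by all <-, u> ⊗ <-, v> lies in       *)
(* R ⊗ C + C ⊗ R, which makes R a coideal. Conversely, by induction on words, *)
(* an element of a coideal of minimal relations acts by zero on T(F), because *)
(* π_x(w)(f u) = Σ π_x(w')(f) π_x(w'')(u).                                    *)

Set Implicit Arguments.
Unset Strict Implicit.
Unset Printing Implicit Defensive.

Import GRing.Theory.
Local Open Scope ring_scope.
Local Open Scope classical_set_scope.
Local Open Scope tensor_scope.

(** Both halves rest on [tensor_repM], the product rule for π_x(w) with w in all of T(L). [Invd_eq0]
    gives [relations_radical]; then [rep_pairingM] and the linear algebra of [tens_set_radical] give
    [relations_coideal]. Maximality is [coideal_minimal_relations]. *)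

Section Flip.
Context {K : fieldType} {U V W : lmodType K} (b : linmap V (linmap W U)).
Fact hom_flip_linearl v : linear (fun w : W => b v w).
Proof. exact: linearP. Qed.
Fact hom_flip_linearr w : linear (fun v : V => b v w).
Proof. by move=> a u v; rewrite linearP. Qed.
Definition hom_flip : linmap W (linmap V U) := mkbil hom_flip_linearl hom_flip_linearr.
Lemma hom_flipE w v : hom_flip w v = b v w. Proof. by []. Qed.
End Flip.

(** * Spans and tensor products of subspaces *)

Section Subspace.
Context {K : fieldType}.

Lemma linsubspaceD (V : lmodType K) (S : set V) u v :
  linsubspace S -> S u -> S v -> S (u + v).
Proof. by case=> _ SP Su Sv; rewrite -[u]scale1r; exact: SP. Qed.

Lemma linsubspaceZ (V : lmodType K) (S : set V) (a : K) u :
  linsubspace S -> S u -> S (a *: u).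
Proof. by case=> S0 SP Su; rewrite -[_ *: _]addr0; exact: SP. Qed.

Lemma linsubspace_sum (V : lmodType K) (S : set V) (I : eqType) (r : seq I)
    (f : I -> V) :
  linsubspace S -> (forall i, i \in r -> S (f i)) -> S (\sum_(i <- r) f i).
Proof.
move=> SS; elim: r => [|i r IHr] Sf; first by rewrite big_nil; case: SS.
rewrite big_cons; apply: linsubspaceD => //; first exact/Sf/mem_head.
by apply: IHr => j jr; apply: Sf; rewrite inE jr orbT.
Qed.

Lemma lspan_linsubspace (V : lmodType K) (G : set V) : linsubspace (lspan G).
Proof.
split=> [S [[S0 _] _] //|a u v Gu Gv S SG].
by case: (SG) => -[_ SP] _; apply: SP; [exact: Gu|exact: Gv].
Qed.

Lemma sub_lspan (V : lmodType K) (G : set V) : G `<=` lspan G.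
Proof. exact: sub_smallest. Qed.

Lemma lspan_min (V : lmodType K) (G S : set V) :
  linsubspace S -> G `<=` S -> lspan G `<=` S.
Proof. by move=> SS GS; exact: smallest_sub. Qed.

Lemma preimage_linsubspace (U V : lmodType K) (f : linmap U V) (S : set V) :
  linsubspace S -> linsubspace (f @^-1` S).
Proof.
move=> [S0 SP]; split=> [|a u v Su Sv]; rewrite /preimage /= ?linear0 //.
by rewrite linearP; exact: SP.
Qed.

Lemma linsubspace_eq0 (V : lmodType K) : linsubspace [set v : V | v = 0].
Proof. by split=> [//|a u v /= -> ->]; rewrite scaler0 addr0. Qed.

Lemma tens_set_pure (V W : lmodType K) (S : set V) (S' : set W) v w :
  S v -> S' w -> tens_set S S' (v ⊗ w).
Proof. by move=> Sv Sw; apply: sub_lspan; exists v => //; exists w. Qed.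

Lemma tens_set_min (V W : lmodType K) (S : set V) (S' : set W) (X : set (V ⊗ W)) :
  linsubspace X -> (forall v w, S v -> S' w -> X (v ⊗ w)) -> tens_set S S' `<=` X.
Proof. by move=> XX SX; apply: lspan_min => // _ [v Sv] [w Sw] <-; exact: SX. Qed.

Lemma tens_map_set (V W V' W' : lmodType K) (f : linmap V V') (g : linmap W W')
    (S : set V) (S' : set W) (X : set V') (X' : set W') t :
  (forall v, S v -> X (f v)) -> (forall w, S' w -> X' (g w)) ->
  tens_set S S' t -> tens_set X X' (tens_map f g t).
Proof.
move=> fS gS; move: t; apply: tens_set_min => [|v w Sv Sw].
  exact: preimage_linsubspace (@lspan_linsubspace _ _).
by rewrite /= tens_map_pure; apply: tens_set_pure; [exact: fS|exact: gS].
Qed.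

End Subspace.

(** * Radical of a pairing on a finite-dimensional subspace *)

Section FiniteDimensionalPairing.
Context {K : fieldType} {V W : lmodType K} (b : linmap V (linmap W K^o)).
Context (C : set V) (C_sub : linsubspace C).

Definition left_radical : set V := C `&` [set v | forall w, b v w = 0].

Lemma left_radical_linsubspace : linsubspace left_radical.
Proof.
have [C0 CP] := C_sub; split=> [|a u v [Cu bu] [Cv bv]].
  by split=> // w; rewrite linear0.
by split=> [|w]; [exact: CP|rewrite linearP homD homZ bu bv scaler0 addr0].
Qed.

Fact finite_rank_linear (l : seq (W * V)) :
  linear (fun v : V => \sum_(p <- l) (b v p.1 : K) *: p.2).
Proof.
move=> a u v; rewrite scaler_sumr -big_split; apply: eq_bigr => p _ /=.
by rewrite linearP homD homZ scalerDl scalerA.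
Qed.
Definition finite_rank l : linmap V V := mkhom (finite_rank_linear l).
Lemma finite_rankE l v :
  finite_rank l v = \sum_(p <- l) (b v p.1 : K) *: p.2.
Proof. by []. Qed.

Lemma finite_rank_in l : (forall p, p \in l -> C p.2) -> forall v, C (finite_rank l v).
Proof.
move=> Cl v; apply: linsubspace_sum => // p pl.
exact/(linsubspaceZ _ C_sub)/Cl.
Qed.

(** This replaces a basis of C modulo its radical together with dual functionals <-, w>. The list is
    built along a spanning list of C, adding a term only when the next vector is not yet corrected
    into the radical. *)
Lemma exists_finite_rank_mod_radical : finite_dim C ->
  exists l : seq (W * V), (forall p, p \in l -> C p.2) /\
    forall v, C v -> left_radical (v - finite_rank l v).
Proof.
case=> s Cs; suff [l [Cl ls]] : exists l : seq (W * V), (forall p, p \in l -> C p.2) /\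
    forall v, v \in s -> left_radical (v - finite_rank l v).
  exists l; split=> // v; rewrite {1}Cs; move: v.
  pose q : linmap V V := hom_id V - finite_rank l.
  exact: (lspan_min (preimage_linsubspace q left_radical_linsubspace)).
have : forall v, v \in s -> C v by move=> v vs; rewrite Cs; exact: sub_lspan.
elim: s {Cs} => [|v s IHs] Cs; first by exists [::].
have /IHs[l [Cl ls]] : forall v, v \in s -> C v.
  by move=> u us; apply: Cs; rewrite inE us orbT.
pose q u := u - finite_rank l u.
have Cq u : C u -> C (q u).
  move=> Cu; apply: linsubspaceD => //; rewrite -scaleN1r.
  by apply: linsubspaceZ => //; exact: finite_rank_in.
have Cv : C v by apply/Cs/mem_head.
have [qv|] := pselect (forall w, b (q v) w = 0).
  exists l; split=> // u; rewrite inE => /orP[/eqP->|/ls//].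
  by split; first exact: Cq.
move=> /existsNP[w /eqP bw].
(* w' is chosen so that <u, w'> = <q u, w>: the functional <-, w'> vanishes   *)
(* on s, and adding the term (w', q v) to l does not spoil what q does there. *)
pose w' := w - \sum_(p <- l) (b p.2 w : K) *: p.1.
have bqw u : b u w' = b (q u) w.
  rewrite /q /w' !linearB /=; congr (_ - _).
  rewrite linear_sum -[RHS](hom_flipE b) linear_sum; apply: eq_bigr => p _.
  by rewrite !linearZ; exact: mulrC.
(* After division by [c], <v, w'> becomes 1, so the new term sends [v] to exactly the missing
   [q v]. *)
pose c : K := b (q v) w.
exists ((c^-1 *: w', q v) :: l); split=> [p|u].
  by rewrite inE => /orP[/eqP->|/Cl//]; exact: Cq.
have -> : u - finite_rank ((c^-1 *: w', q v) :: l) u =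
    q u - (c^-1 * (b (q u) w : K)) *: q v.
  by rewrite /= big_cons [b u _]linearZ bqw opprD addrCA addrC.
rewrite inE => /orP[/eqP->|/ls us].
  rewrite mulVf // scale1r subrr.
  by case: left_radical_linsubspace.
by have [_ /(_ w)->] := us; rewrite mulr0 scale0r subr0.
Qed.

(** On C, write id = q + r with q valued in the radical and r of finite rank. The coefficients of (r
    ⊗ r)(t) are values of <-, u> ⊗ <-, v> at t, hence zero; every other term has a factor q. *)
Lemma tens_set_radical t : finite_dim C -> tens_set C C t ->
  (forall u v, tens_lift alg_mul (tens_map (hom_flip b u) (hom_flip b v) t) = 0) ->
  sum_set (tens_set left_radical C) (tens_set C left_radical) t.
Proof.
move=> /exists_finite_rank_mod_radical[l [Cl lR]] Ct bt.
pose r := finite_rank l; pose q : linmap V V := hom_id V - r.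
have rr : tens_map r r t = 0.
  suff -> : tens_map r r t = \sum_(p <- l) \sum_(p' <- l)
      (tens_lift alg_mul (tens_map (hom_flip b p.1) (hom_flip b p'.1) t) : K)
        *: (p.2 ⊗ p'.2).
    by rewrite big1 // => p _; rewrite big1 // => p' _; rewrite bt scale0r.
  move: t {Ct bt}; apply: tens_ind => [v w|s s' IHs IHs']; last first.
    rewrite linearD IHs IHs' -big_split; apply: eq_bigr => p _ /=.
    rewrite -big_split; apply: eq_bigr => p' _ /=.
    by rewrite !linearD scalerDl.
  rewrite tens_map_pure !finite_rankE -(hom_flipE tens_pure) linear_sum.
  apply: eq_bigr => p _.
  rewrite hom_flipE linear_sum; apply: eq_bigr => p' _.
  by rewrite tens_map_pure tens_lift_pure !linearZ /= scalerA; congr (_ *: _); exact: mulrC.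
(* id ⊗ id = q ⊗ id + r ⊗ q + r ⊗ r *)
exists (tens_map q (hom_id V) t).
  by apply: tens_map_set Ct => v Cv //; exact: lR.
exists (tens_map r q t).
  by apply: tens_map_set Ct => v Cv; [exact: finite_rank_in|exact: lR].
rewrite -[RHS]subr0 -rr.
move: t {Ct bt rr}; apply: tens_ind => [v w|s s' IHs IHs'].
  rewrite !tens_map_pure /=.
  by rewrite linearB homD linearB /= addrA subrK.
by rewrite !linearD [LHS]addrACA IHs IHs' addrACA.
Qed.

End FiniteDimensionalPairing.

(** The counit axiom applied to A d, combined with invariance, gives A = ((ε ∘ A) ⊗ id) ∘ Δ. *)
Lemma Invd_eq0 (K : fieldType) (D : coalgType K) (A : endo D) :
  Invd D A -> (forall d, counit (A d) = 0) -> A = 0.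
Proof.
move=> Ainv eA; apply: hom_ext => d.
have := counitl (A d); rewrite Ainv tens_map_comp.
have -> : hom_comp counit A = 0 by apply: hom_ext => e; exact: eA.
move=> /(congr1 (scalingl (hom_id D))).
rewrite scalingl_pure scale1r => /= <-.
have -> : tens_map 0 (hom_comp (hom_id D) (hom_id D)) =
    (0 : linmap (D ⊗ D)%type (K^o ⊗ D)%type).
  by apply: tens_hom_ext => u v; rewrite tens_map_pure !hom0 linear0.
by rewrite linear0.
Qed.

(** * The pairing of T(L) with T(F) *)

Section TensorRepresentation.
Context {K : fieldType} {L F : coalgType K} (x : linmap L (endo F)).
Local Notation T := (tensalg F).
Local Notation ι := tensalg_inj.

(** Counterpart of [tensor_conv] with T(L) in place of L; the convolution product on the target
    encodes Σ π_x(w')(u) π_x(w'')(v). *)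
Definition rep_orbit : linmap T (conv (tensalg L) T) :=
  hom_flip (tensor_rep x).

Lemma tensor_rep1 w : tensor_rep x w 𝟙 = (counit w : K) *: 𝟙.
Proof.
have [r1 rM] := tensor_rep_morphism x.
have [e1 eM] := @tensalg_counit_morphism K L.
move: w; apply: tensalg_ind => [|l w IHw|a s t IHs IHt].
- by rewrite r1 e1 scale1r.
- rewrite rM endo_mulE IHw tensor_rep_inj linearZ tensor_op1 /= scalerA.
  by rewrite eM tensalg_counit_inj; congr (_ *: _); exact: mulrC.
by rewrite linearP homD homZ IHs IHt linearP scalerDl scalerA.
Qed.

(** The rule holds for letters by [tensor_opM] and passes to words because the coproduct of T(L) is
    multiplicative. *)
Lemma tensor_repM w u v : tensor_rep x w (u ⋆ v) = (rep_orbit u ⋆ rep_orbit v) w.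
Proof.
rewrite conv_mulE.
have [r1 rM] := tensor_rep_morphism x.
have [D1 DM] := @tensalg_comult_morphism K L.
move: w; apply: tensalg_ind => [|l w IHw|a s t IHs IHt].
- by rewrite r1 D1 tens_map_pure tens_lift_pure /= r1.
- rewrite rM endo_mulE IHw tensor_rep_inj DM tensalg_comult_inj.
  move: (comult w) => t; move: t {IHw}; apply: tens_ind => [w1 w2|s t IHs IHt].
    rewrite tens_map_pure tens_lift_pure tensor_opM.
    move: (comult l) => t; move: t; apply: tens_ind => [l1 l2|s t IHs IHt].
      rewrite !tens_map_pure tens_mulE tens_map_pure !tens_lift_pure /=.
      by rewrite !rM !tensor_rep_inj.
    by rewrite !(linearD (tens_map _ _)) alg_mulDl !linearD IHs IHt.
  by rewrite !linearD IHs IHt.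
by rewrite linearP homD homZ IHs IHt !linearP.
Qed.

Definition rep_pairing : linmap (tensalg L) (linmap T K^o) :=
  hom_flip (mkbil
    (fun w => linearP (hom_comp (@counit K T) (tensor_rep x w)))
    (fun u => linearP (hom_comp (@counit K T) (rep_orbit u)))).

Lemma rep_pairingE w u : rep_pairing w u = counit (tensor_rep x w u).
Proof. by []. Qed.

Lemma rep_pairingM w u v : rep_pairing w (u ⋆ v) =
  tens_lift alg_mul
    (tens_map (hom_flip rep_pairing u) (hom_flip rep_pairing v) (comult w)).
Proof.
rewrite rep_pairingE tensor_repM conv_mulE.
have [_ eM] := @tensalg_counit_morphism K F.
move: (comult w) => t; move: t; apply: tens_ind => [w1 w2|s t IHs IHt].
  by rewrite !tens_map_pure !tens_lift_pure eM.
by rewrite !linearD IHs IHt.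
Qed.

Lemma relations_radical (C : set (tensalg L)) : (forall l, Invd F (x l)) ->
  relations x C = left_radical rep_pairing C.
Proof.
move=> xinv; apply/seteqP; split=> w [Cw rw]; split=> //.
  by move=> u; rewrite rep_pairingE rw linear0.
exact: (Invd_eq0 (tensor_rep_Invd xinv w)).
Qed.

Lemma relations_coideal (C : set (tensalg L)) : (forall l, Invd F (x l)) ->
  subcoalgebra C -> finite_dim C -> coideal C (relations x C).
Proof.
move=> xinv [Csub CD] Cfin; rewrite relations_radical //; split.
- exact: left_radical_linsubspace.
- by move=> w [].
- move=> w [Cw bw]; apply: tens_set_radical => //; first exact: CD.
  by move=> u v; rewrite -rep_pairingM bw.
(* Pairing with 1 recovers the counit: <w, 1> = ε(w). *)
move=> w [_ /(_ 𝟙)]; rewrite rep_pairingE tensor_rep1 linearZ /=.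
have [-> _] := @tensalg_counit_morphism K F.
by rewrite [_ *: _]mulr1.
Qed.

Lemma coideal_minimal_relations (C I : set (tensalg L)) :
  coideal C I -> I `<=` minimal_relations x C -> I `<=` relations x C.
Proof.
move=> [_ IC ID Ie] Imin w Iw; split; first exact: IC.
apply: hom_ext => u; rewrite hom0; move: u w Iw.
apply: tensalg_ind => [w Iw|f u IHu w Iw|a s t IHs IHt w Iw]; last first.
- by rewrite linearP IHs // IHt // scaler0 addr0.
- rewrite tensor_repM conv_mulE.
  pose g := hom_comp (tens_lift alg_mul) (tens_map (rep_orbit (ι f)) (rep_orbit u)).
  have [s Is [t It <-]] := ID w Iw; rewrite -[LHS]/(g (s + t)) linearD.
  have g0 := preimage_linsubspace g (@linsubspace_eq0 _ _).
  (* On I ⊗ C the left factor kills the letter [f], by minimality; on C ⊗ I the right factor kills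
     [u], by induction. *)
  have -> : g s = 0.
    move: s Is; apply: (tens_set_min g0) => v v' /Imin[_ v0] _ /=.
    rewrite tens_map_pure tens_lift_pure /= v0 ?linear0 //.
    by exists 0 => //; exists f => //; rewrite scale0r add0r.
  suff -> : g t = 0 by rewrite addr0.
  move: t It; apply: (tens_set_min g0) => v v' _ Iv' /=.
  by rewrite tens_map_pure tens_lift_pure /= IHu // linear0.
(* On the empty word, [w] acts by ε(w), which vanishes on a coideal. *)
by rewrite tensor_rep1 Ie // scale0r.
Qed.

End TensorRepresentation.

Theorem mainTheorem5 (R : realType) (L F : finCoalgType R[i])
  (x : linmap L (endo F)) (x_Invd : forall l : L, Invd F (x l))
  (C : set (tensalg L)) (C_subcoalgebra : subcoalgebra C)
  (C_finite_dim : finite_dim C) :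
  maximal_coideal_in C (minimal_relations x C) (relations x C).
Proof.
split; first exact: relations_coideal.
  by move=> w [Cw rw]; split=> // u _; rewrite rw.
by move=> I; exact: coideal_minimal_relations.
Qed.
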